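(* Let $d\ge 1$, let $G=(V,E)$ be a graph, and let $p:V\to\mathbb{R}^d$ be a map whose image is not contained in any affine hyperplane of $\mathbb{R}^d$ (in particular $|V|\ge d+1$). Then, for all integers $k\ge 2$, as multisets, $$\mathrm{Spec}\left(L(G^{(k)},p^{(k)})\right)=k\left(\left(\bigcup_{v\in V}\mathrm{Spec}(L^v(G,p))^{[k-1]}\right)\cup\mathrm{Spec}(L(G,p))\right).$$ In particular, $$\lambda_{\binom{d+1}{2}+1}\left(L(G^{(k)},p^{(k)})\right)=\frac{k}{2}\cdot\lambda_{\binom{d+1}{2}+1}\left(L(G^{(2)},p^{(2)})\right).$$
   Context: All graphs are finite and simple. For a graph $G=(V,E)$ and $p:V\to\mathbb{R}^d$ (not necessarily injective), for $u,v\in V$ put $d_{uv}=\frac{p(u)-p(v)}{\|p(u)-p(v)\|}$ if $p(u)\neq p(v)$ and $d_{uv}=0$ otherwise. The rigidity matrix $R(G,p)\in\mathbb{R}^{d|V|\times|E|}$ has rows indexed by pairs $(u,i)$, $u\in V$, $1\le i\le d$, columns indexed by edges, and entries $R(G,p)_{(u,i),e}=(d_{uv})_i$ if $e=\{u,v\}$ for some $v\in V$, and $0$ if $u\notin e$. The stiffness matrix is $L(G,p)=R(G,p)R(G,p)^{\top}$. For $v\in V$ with neighbor set $N_G(v)$, $R^v(G,p)\in\mathbb{R}^{d\times|N_G(v)|}$ is the matrix whose column indexed by $u\in N_G(v)$ is $d_{vu}$, and $L^v(G,p)=R^v(G,p)R^v(G,p)^{\top}\in\mathbb{R}^{d\times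 d}$. For an integer $k\ge1$, the blow-up $G^{(k)}$ has vertex set $\{(v,i):v\in V,1\le i\le k\}$ and edge set $\{\{(u,i),(v,j)\}:\{u,v\}\in E,\ 1\le i,j\le k\}$, and $p^{(k)}((v,i))=p(v)$. For a symmetric real matrix $M$, $\mathrm{Spec}(M)$ is the multiset of its eigenvalues and $\lambda_i(M)$ its $i$-th smallest eigenvalue (with multiplicity). For a multiset $S$, an integer $k\ge0$ and $\alpha\in\mathbb{R}$, $S^{[k]}$ is the multiset in which each element of $S$ is repeated $k$ times ($S^{[0]}=\emptyset$), and $\alpha S$ is obtained by multiplying each element by $\alpha$. Unions of multisets add multiplicities. *)

(* Defs.v *)
From HB Require Import structures.
From mathcomp Require Import all_boot all_order all_algebra.
From mathcomp Require Export polyrcf reals.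

Set Implicit Arguments.
Unset Strict Implicit.
Unset Printing Implicit Defensive.

Import Order.TTheory GRing.Theory Num.Theory.

Local Open Scope ring_scope.

Record sgraph := SGraph {
  vertex :> finType;
  adj : rel vertex;
  adj_sym : symmetric adj;
  adj_irrefl : irreflexive adj }.

Definition edges (G : sgraph) : {set {set G}} :=
  [set [set x.1; x.2] | x : G * G & adj x.1 x.2].

Definition neighbors (G : sgraph) (v : G) : {set G} := [set u | adj v u].

Section BlowUp.
Variables (G : sgraph) (k : nat).

Definition blowup_adj : rel (G * 'I_k) := fun x y => adj x.1 y.1.

Lemma blowup_adj_sym : symmetric blowup_adj.
Proof. by move=> x y; apply: adj_sym. Qed.

Lemma blowup_adj_irrefl : irreflexive blowup_adj.
Proof. by move=> x; apply: adj_irrefl. Qed.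

Definition blowup : sgraph := SGraph blowup_adj_sym blowup_adj_irrefl.

Definition blowup_map (T : Type) (p : G -> T) : blowup -> T := fun x => p x.1.

End BlowUp.

Section Frameworks.
Variables (R : rcfType) (d : nat).

(* The Euclidean norm; the norm that the libraries put on matrices is the
   sup norm. *)
Definition enorm (x : 'cV[R]_d) : R := Num.sqrt (\sum_i x i 0 ^+ 2).

Definition direction (x y : 'cV[R]_d) : 'cV[R]_d :=
  if x == y then 0 else (enorm (x - y))^-1 *: (x - y).

Definition in_affine_hyperplane (T : Type) (p : T -> 'cV[R]_d) : Prop :=
  exists (a : 'cV[R]_d) (b : R),
    a != 0 /\ forall v, \sum_i a i 0 * p v i 0 = b.

Variables (G : sgraph) (p : G -> 'cV[R]_d).

(* The v with E = [set u; v] is unique when E is an edge containing u, and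
   there is none when u is not in E. *)
Definition rigidity_entry (u : G) (i : 'I_d) (E : {set G}) : R :=
  if [pick v | E == [set u; v]] is Some v
  then direction (p u) (p v) i 0 else 0.

(* Rows are indexed by the pairs (u, i) and columns by the edges, through
   their canonical enumerations. *)
Definition rigidity_mx : 'M[R]_(#|{: G * 'I_d}|, #|edges G|) :=
  \matrix_(r, c) rigidity_entry (enum_val r).1 (enum_val r).2 (enum_val c).

Definition stiffness_mx : 'M[R]_#|{: G * 'I_d}| := rigidity_mx *m rigidity_mx^T.

Definition local_rigidity_mx (v : G) : 'M[R]_(d, #|neighbors v|) :=
  \matrix_(i, c) direction (p v) (p (enum_val c)) i 0.

Definition local_stiffness_mx (v : G) : 'M[R]_d :=
  local_rigidity_mx v *m (local_rigidity_mx v)^T.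

End Frameworks.

(* Finite multisets are sequences compared up to perm_eq, so that the union
   adding multiplicities is concatenation. *)
Section Multisets.
Variable R : rcfType.

(* Each real root of the characteristic polynomial, repeated according to its
   multiplicity. *)
Definition spec n (M : 'M[R]_n) : seq R :=
  flatten [seq nseq (mup a (char_poly M)) a | a <- rootsR (char_poly M)].

Lemma count_spec n (M : 'M[R]_n) a :
  count_mem a (spec M) = mup a (char_poly M).
Proof.
have nz : char_poly M != 0 by rewrite monic_neq0 ?char_poly_monic.
rewrite /spec count_flatten -map_comp.
have -> : sumn [seq (count_mem a \o
      (fun b => nseq (mup b (char_poly M)) b)) b | b <- rootsR (char_poly M)]
    = \sum_(b <- rootsR (char_poly M) | b == a) mup a (char_poly M).
  rewrite sumnE big_map [RHS]big_mkcond /=; apply: eq_bigr => b _.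
  by rewrite count_nseq /=; case: eqP => [->|_]; rewrite ?mul1n ?mul0n.
rewrite big_const_seq iter_addn_0 count_uniq_mem ?uniq_roots //.
have -> : (a \in rootsR (char_poly M)) = root (char_poly M) a.
  by rewrite -(roots_on_rootsR nz) in_itv.
by case: (boolP (root _ a)) => [_|/mupNroot->]; rewrite ?muln1 ?mul0n.
Qed.

(* The i-th smallest eigenvalue, counted from i = 1. *)
Definition lambda n (i : nat) (M : 'M[R]_n) : R :=
  nth 0 (sort <=%R (spec M)) i.-1.

Definition mset_repeat (k : nat) (s : seq R) : seq R := flatten (nseq k s).

Definition mset_scale (a : R) (s : seq R) : seq R := [seq a * x | x <- s].

End Multisets.

(* Main.v *)
Require Import Defs.
From mathcomp Require Import all_boot all_order all_algebra.
From mathcomp Require Import perm polyrcf mxtens reals.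
From mathcomp Require Import ring.

Set Implicit Arguments.
Unset Strict Implicit.
Unset Printing Implicit Defensive.

Import Order.TTheory GRing.Theory Num.Theory.

Local Open Scope ring_scope.

(** Let L be the stiffness matrix of (G, p) and D the block-diagonal matrix with
    blocks L^v.  The (u, v) block of L is L^u when u = v, the matrix
    - d_uv d_uv^T when uv is an edge, and 0 otherwise ([stiffness_mxE]).  In the
    blow-up, every copy of u sees each neighbour of u exactly k times, so its
    diagonal block is k L^u; two distinct copies of u are not adjacent, and
    copies of u and v interact as u and v do.  After moving the copy index to
    the front, the stiffness matrix of the blow-up is therefore the tensor
    expression J (x) (L - D) + 1 (x) kD, where J is the all-ones matrix of
    size k.

    On the vectors that are constant along the copies, J acts as k and the
    expression becomes kL; on the quotient, J acts as 0 and k - 1 copies of kD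
    remain.  Hence the characteristic polynomial of the blow-up is
    char(kL) * char(kD)^(k - 1) ([char_poly_stiffness_blowup]), where char(kD)
    is the product of the char(k L^v).  Comparing root multiplicities gives the
    equality of multisets.

    For the eigenvalue of index m + 1, with m = C(d+1, 2): all the matrices
    involved are Gram matrices, so all eigenvalues are nonnegative
    ([spec_gram_ge0]), and the infinitesimal isometries of R^d give m
    independent kernel vectors of L, because the points affinely span R^d
    ([count0_spec_stiffness]).  Remove m zeros from Spec(L), leaving z.  Then
    Spec of the blow-up, divided by k, is m zeros together with the union of z
    and k - 1 copies of the Spec(L^v), and its entry of index m + 1 is the
    smallest element of that union.  As a set the union does not depend on
    k >= 2, so the eigenvalue is proportional to k. *)

(** * Characteristic polynomials of block and tensor matrices *)

Lemma char_poly_reindex (R : comNzRingType) m n (A : 'M[R]_m) (B : 'M[R]_n)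
    (h : 'I_m -> 'I_n) :
  m = n -> injective h -> (forall i j, A i j = B (h i) (h j)) ->
  char_poly A = char_poly B.
Proof.
move=> emn; subst n => h_inj AB; pose s := perm h_inj.
rewrite /char_poly.
have -> : char_poly_mx A
    = perm_mx s *m char_poly_mx B *m (perm_mx s)^T.
  rewrite tr_perm_mx -row_permE -col_permE.
  apply/matrixP=> i j; rewrite !mxE !permE AB; congr (_ *+ _ - _).
  by rewrite (inj_eq h_inj).
by rewrite !det_mulmx det_tr det_perm mulrAC -expr2 sqrr_sign mul1r.
Qed.

Lemma char_poly_sim (R : comNzRingType) n (P Q A B : 'M[R]_n) :
  P *m Q = 1%:M -> P *m A = B *m P -> char_poly A = char_poly B.
Proof.
move=> PQ PA.
pose c (M : 'M[R]_n) := map_mx (@polyC R) M.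
have cM (M N : 'M[R]_n) : c (M *m N) = c M *m c N by apply: map_mxM.
have cPQ : \det (c P) * \det (c Q) = 1.
  by rewrite -det_mulmx -cM PQ /c map_mx1 det1.
have E : c P *m char_poly_mx A = char_poly_mx B *m c P.
  rewrite /char_poly_mx mulmxBr mulmxBl scalar_mxC.
  by rewrite -/(c A) -/(c B) -!cM PA.
rewrite /char_poly -[LHS]mulr1 -cPQ mulrA [_ * \det (c P)]mulrC -det_mulmx E.
by rewrite det_mulmx -mulrA cPQ mulr1.
Qed.

Lemma char_poly_lblock (R : comNzRingType) m n (A : 'M[R]_m)
    (C : 'M[R]_(n, m)) (D : 'M[R]_n) :
  char_poly (block_mx A 0 C D) = char_poly A * char_poly D.
Proof.
rewrite /char_poly /char_poly_mx map_block_mx map_mx0 scalar_mx_block.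
by rewrite opp_block_mx add_block_mx oppr0 addr0 det_lblock.
Qed.

(** Splitting off the first block of a matrix indexed by pairs (block, entry):
    the row-major index of such pairs makes 'I_(m.+1 * n) and 'I_(n + m * n)
    agree value by value, so that only a cast separates M from a [block_mx]. *)
Lemma char_poly_tens_lblock (R : comNzRingType) m n (M : 'M[R]_(m.+1 * n)) :
  (forall i j a,
     M (mxtens_index (ord0, i)) (mxtens_index (lift ord0 a, j)) = 0) ->
  char_poly M
  = char_poly (\matrix_(i, j)
      M (mxtens_index (ord0, i)) (mxtens_index (ord0, j)))
  * char_poly (\matrix_(i < m * n, j < m * n)
      M (mxtens_index (lift ord0 (mxtens_unindex i).1, (mxtens_unindex i).2))
        (mxtens_index (lift ord0 (mxtens_unindex j).1, (mxtens_unindex j).2))).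
Proof.
move=> M0; set A := (X in _ = char_poly X * _); set D := (X in _ * char_poly X).
pose h : 'I_(n + m * n) -> 'I_(m.+1 * n) := cast_ord (esym (mulSn m n)).
have hl i : h (lshift _ i) = mxtens_index (ord0, i) by apply: val_inj.
have hr j : h (rshift _ j)
    = mxtens_index (lift ord0 (mxtens_unindex j).1, (mxtens_unindex j).2).
  by apply: val_inj; rewrite /= mulnDl mul1n -addnA -divn_eq.
pose C := \matrix_(i, j) M (h (rshift n i)) (h (lshift (m * n) j)).
rewrite -(char_poly_lblock A C D); apply/esym.
apply: (char_poly_reindex (h := h)) => [|i j /cast_ord_inj //|i j].
  by rewrite mulSn.
case: (split_ordP i) => a ->; case: (split_ordP j) => b ->.
- by rewrite block_mxEul mxE !hl.
- by rewrite block_mxEur mxE hl hr M0.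
- by rewrite block_mxEdl mxE.
- by rewrite block_mxEdr mxE !hr.
Qed.

Definition block_diag (R : nzRingType) m n (f : 'I_m -> 'M[R]_n)
    : 'M[R]_(m * n) :=
  \matrix_(i, j)
    (f (mxtens_unindex i).1 (mxtens_unindex i).2 (mxtens_unindex j).2
    *+ ((mxtens_unindex i).1 == (mxtens_unindex j).1)).

Lemma char_poly_block_diag (R : comNzRingType) m n (f : 'I_m -> 'M[R]_n) :
  char_poly (block_diag f) = \prod_i char_poly (f i).
Proof.
elim: m f => [|m IH] f; first by rewrite big_ord0 /char_poly det_mx00.
rewrite char_poly_tens_lblock => [|i j a]; last by rewrite mxE !mxtens_indexK.
rewrite big_ord_recl -IH; congr (_ * _); congr char_poly.
  by apply/matrixP=> i j; rewrite !mxE !mxtens_indexK.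
by apply/matrixP=> i j; rewrite !mxE !mxtens_indexK /= (inj_eq lift_inj).
Qed.

(** The all-ones matrix J is conjugated, by the unipotent 1 + N below, to the
    matrix T supported on the first column, with entries m.+1, 1, ..., 1.  This
    makes the tensor expression block triangular; a triangular form is enough
    for characteristic polynomials, and, unlike the diagonal one, it is reached
    without dividing by m.+1. *)
Lemma char_poly_ones_tens (R : comNzRingType) m n (A C : 'M[R]_n) :
  char_poly ((const_mx 1 : 'M_m.+1) *t A + 1%:M *t C)
  = char_poly (m.+1%:R *: A + C) * char_poly C ^+ m.
Proof.
(* The first row of 1 + N is (1, ..., 1), the eigenvector of J for m.+1. *)
pose N : 'M[R]_m.+1 := \matrix_(i, j) ((i == ord0) && (j != ord0))%:R.
pose T : 'M[R]_m.+1 :=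
  \matrix_(i, j) ((if i == ord0 then m.+1%:R else 1) *+ (j == ord0)).
have NN : N *m N = 0.
  apply/matrixP=> i j; rewrite !mxE big1 // => l _; rewrite !mxE.
  by case: (l == ord0); rewrite ?andbF ?mul0r // mulr0.
have PQ : (1%:M + N) *m (1%:M - N) = 1%:M.
  by rewrite mulmxBr mulmx1 mulmxDl mul1mx NN addr0 addrK.
have sumN i : \sum_j N i j = (if i == ord0 then m%:R else 0).
  rewrite big_ord_recl !mxE eqxx andbF add0r.
  under eq_bigr do rewrite mxE andbT.
  rewrite sumr_const card_ord; case: eqP => // _; by rewrite mul0rn.
have PJ : (1%:M + N) *m const_mx 1 = T *m (1%:M + N).
  apply/matrixP=> i j; rewrite !mxE.
  under eq_bigr do rewrite mxE [const_mx _ _ _]mxE mulr1.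
  rewrite big_split /= sumN (bigD1 i) //= big1 => [|l li]; last first.
    by rewrite mxE eq_sym (negbTE li).
  rewrite mxE eqxx addr0 (bigD1 ord0) //= big1 => [|l l0]; last first.
    by rewrite [T _ _]mxE (negbTE l0) mul0r.
  rewrite !mxE eqxx mulr1n addr0 [ord0 == j]eq_sym /=.
  have -> : (j == ord0)%:R + (j != ord0)%:R = 1 :> R.
    by case: eqP; rewrite ?addr0 ?add0r.
  by rewrite mulr1; case: eqP => _; rewrite ?addr0 ?nat1r.
have tD (B B' : 'M[R]_m.+1) : (B + B') *t A = B *t A + B' *t A.
  by apply/matrixP=> i j; rewrite !mxE mulrDl.
rewrite (@char_poly_sim _ _ ((1%:M + N) *t 1%:M) ((1%:M - N) *t 1%:M)
   _ (T *t A + 1%:M *t C)); first last.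
- by rewrite mulmxDl mulmxDr !tensmx_mul !(mul1mx, mulmx1) PJ.
- rewrite tensmx_mul PQ mulmx1; apply/matrixP=> i j.
  case: (mxtens_indexP i) (mxtens_indexP j) => a b [a' b'].
  by rewrite tensmxE !mxE (can_eq (@mxtens_indexK _ _)) -natrM mulnb.
rewrite char_poly_tens_lblock => [|i j a]; last first.
  by rewrite mxE !tensmxE !mxE eq_sym /= mulr0n !mul0r addr0.
have -> : char_poly C ^+ m = char_poly (block_diag (fun _ : 'I_m => C)).
  by rewrite char_poly_block_diag prodr_const card_ord.
congr (_ * _); congr char_poly.
  apply/matrixP=> i j.
  by rewrite mxE [LHS]mxE !tensmxE !mxE !eqxx /= mulr1n mul1r.
apply/matrixP=> i j; rewrite mxE [LHS]mxE !tensmxE !mxE /= mulr0n mul0r add0r.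
by rewrite (inj_eq lift_inj) mulr_natl.
Qed.

(** * Multiplicities of eigenvalues *)

Lemma char_poly_scale (R : fieldType) n (c : R) (M : 'M[R]_n) :
  c != 0 ->
  char_poly (c *: M) = (c ^+ n) *: (char_poly M \Po (c^-1 *: 'X)).
Proof.
move=> c0.
rewrite /char_poly -det_map_mx -mul_polyC rmorphXn /= -detZ; congr (\det _).
apply/matrixP=> i j; rewrite !mxE rmorphB rmorphMn /= comp_polyX comp_polyC.
by rewrite mulrBr -polyCM [in RHS]mulrnAr mul_polyC scalerA mulfV // scale1r.
Qed.

Lemma mup_char_poly_scale (R : fieldType) n (c a : R) (M : 'M[R]_n) :
  c != 0 -> mup (c * a) (char_poly (c *: M)) = mup a (char_poly M).
Proof.
have nz (N : 'M[R]_n) : char_poly N != 0 by rewrite monic_neq0 ?char_poly_monic.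
(* One inequality suffices: the other is the same for c^-1 and c *: M. *)
have le (b x : R) (N : 'M[R]_n) : b != 0 ->
    (mup x (char_poly N) <= mup (b * x) (char_poly (b *: N)))%N.
  move=> b0; rewrite mup_geq //.
  have : (mup x (char_poly N) <= mup x (char_poly N))%N by [].
  rewrite mup_geq //.
  set m := mup _ _ => /dvdpP [q Eq].
  rewrite char_poly_scale // Eq comp_polyM rmorphXn rmorphB /=.
  rewrite comp_polyX comp_polyC.
  rewrite dvdpZr ?expf_neq0 //; apply: dvdp_mull.
  have -> : b^-1 *: 'X - x%:P = b^-1 *: ('X - (b * x)%:P).
    by rewrite scalerBr polyCM mul_polyC scalerA mulVf // scale1r.
  by rewrite exprZn dvdpZr // expf_neq0 // invr_eq0.
move=> c0; apply/eqP; rewrite eqn_leq le // andbT.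
have := le c^-1 (c * a) (c *: M); rewrite invr_eq0 => /(_ c0).
by rewrite scalerA !mulrA mulVf // scale1r mul1r.
Qed.

(** The geometric multiplicity of the eigenvalue 0 is at most the algebraic one.
    Gaussian elimination makes M similar to a matrix whose rows of index at
    least r = \rank M vanish; in its characteristic matrix those rows are 'X
    times rows of the identity, and each contributes a factor 'X. *)
Lemma mup0_char_poly_rank (R : fieldType) n (M : 'M[R]_n) :
  (n - \rank M <= mup 0 (char_poly M))%N.
Proof.
rewrite mup_geq ?monic_neq0 ?char_poly_monic // subr0.
set r := \rank M; set L := col_ebase M; set U := row_ebase M.
have ML : invmx L *m M = (pid_mx r *m (U *m L)) *m invmx L.
  have eM : M = L *m pid_mx r *m U by rewrite mulmx_ebase.
  rewrite {1}eM !mulmxA mulVmx ?col_ebase_unit // mul1mx.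
  by rewrite mulmxK ?col_ebase_unit.
rewrite (char_poly_sim (Q := L) _ ML) ?mulVmx ?col_ebase_unit //.
set B := U *m L; rewrite /char_poly.
pose d : 'rV[{poly R}]_n := \row_i (if (i < r)%N then 1 else 'X).
pose B' : 'M[{poly R}]_n :=
  \matrix_(i, j) (if (i < r)%N then char_poly_mx (pid_mx r *m B) i j
                  else (i == j)%:R).
have -> : char_poly_mx (pid_mx r *m B) = diag_mx d *m B'.
  apply/matrixP=> i j; rewrite mul_diag_mx [RHS]mxE.
  have -> : d 0 i = if (i < r)%N then 1 else 'X by rewrite mxE.
  have -> : B' i j = if (i < r)%N then char_poly_mx (pid_mx r *m B) i j
                     else (i == j)%:R by rewrite mxE.
  case: ifP => ir; rewrite ?mul1r // !mxE big1 ?subr0 ?mulr_natr // => l _.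
  by rewrite mxE ir andbF mul0r.
rewrite det_mulmx det_diag dvdp_mulr //.
under eq_bigr do rewrite mxE.
rewrite (bigID (fun i : 'I_n => (i < r)%N)) /= big1 => [|i ->] //.
rewrite mul1r.
rewrite (eq_bigr (fun=> 'X)) => [|i /negbTE-> //].
rewrite prodr_const dvdp_exp2l // [leqRHS](_ : _ = n - r)%N //.
rewrite -sum1_card (eq_bigl (fun i : 'I_n => (r <= i)%N)); last first.
  by move=> i; rewrite unfold_in /= -leqNgt.
rewrite -(big_mkord (fun i => r <= i)%N (fun=> 1%N)).
by rewrite -(big_nat_widenl _ _ _ predT _ (leq0n r)) sum_nat_const_nat muln1.
Qed.

Lemma mup_prod (F : fieldType) (I : finType) (f : I -> {poly F}) x :
  (forall i, f i != 0) -> mup x (\prod_i f i) = (\sum_i mup x (f i))%N.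
Proof.
move=> f0.
suff [] : \prod_i f i != 0
    /\ mup x (\prod_i f i) = (\sum_i mup x (f i))%N by [].
apply: (big_rec2 (fun p n => p != 0 /\ mup x p = n)) => [|i n q _ [q0 <-]].
  by split; [exact: oner_neq0 | rewrite mupNroot // root1].
by split; [rewrite mulf_neq0 | rewrite mupM].
Qed.

Lemma mup_exp (F : fieldType) (q : {poly F}) x m :
  q != 0 -> mup x (q ^+ m) = (m * mup x q)%N.
Proof.
move=> q0; elim: m => [|m IH]; first by rewrite mupNroot // root1.
by rewrite exprS mupM ?expf_neq0 // IH mulSn.
Qed.

(** If v M M^T = a v with v nonzero, then a |v|^2 = |v M|^2. *)
Lemma spec_gram_ge0 (R : rcfType) m n (M : 'M[R]_(m, n)) a :
  a \in spec (M *m M^T) -> 0 <= a.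
Proof.
rewrite -has_pred1 has_count count_spec => mup_gt0.
have: root (char_poly (M *m M^T)) a.
  by apply: contraLR mup_gt0 => /mupNroot->.
rewrite -eigenvalue_root_char => /eigenvalueP[v vM v0].
have sqE k (x : 'rV[R]_k) : (x *m x^T) 0 0 = \sum_i x 0 i ^+ 2.
  by rewrite mxE; apply: eq_bigr => i _; rewrite mxE.
have sq_ge0 k (x : 'rV[R]_k) : 0 <= (x *m x^T) 0 0.
  by rewrite sqE sumr_ge0 // => i _; rewrite sqr_ge0.
have sq_gt0 : 0 < (v *m v^T) 0 0.
  rewrite lt_def sq_ge0 andbT; apply: contra_neq v0 => /eqP.
  rewrite sqE psumr_eq0 => [/allP z|i _]; last exact: sqr_ge0.
  apply/rowP=> i; rewrite mxE; apply/eqP.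
  by rewrite -sqrf_eq0 (implyP (z i _)) ?mem_index_enum.
rewrite -(pmulr_lge0 _ sq_gt0).
have <- : (v *m M *m (v *m M)^T) 0 0 = a * (v *m v^T) 0 0; last exact: sq_ge0.
by rewrite trmx_mul mulmxA -[v *m M *m _]mulmxA vM -scalemxAl mxE.
Qed.

(** * Entries of the stiffness matrix *)

Lemma direction_opp (R : rcfType) d (x y : 'cV[R]_d) :
  direction y x = - direction x y.
Proof.
rewrite /direction eq_sym; case: eqP => _; first by rewrite oppr0.
have -> : enorm (y - x) = enorm (x - y).
  by congr (Num.sqrt _); apply: eq_bigr => i _; rewrite !mxE -opprB sqrrN.
by rewrite -scalerN opprB.
Qed.

Lemma directionE (R : rcfType) d (x y : 'cV[R]_d) :
  exists a : R, direction x y = a *: (x - y).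
Proof.
rewrite /direction; case: eqP => _; last by exists (enorm (x - y))^-1.
by exists 0; rewrite scale0r.
Qed.

Section Entries.
Variables (R : rcfType) (d : nat) (G : sgraph) (p : G -> 'cV[R]_d).

Lemma adj_neq (u v : G) : adj u v -> u != v.
Proof. by apply: contraL => /eqP->; rewrite adj_irrefl. Qed.

Lemma edgeP (E : {set G}) :
  reflect (exists u v, adj u v /\ E = [set u; v]) (E \in edges G).
Proof.
apply: (iffP imsetP) => [[[u v]]|[u [v [uv ->]]]].
  by rewrite inE /= => uv ->; exists u, v.
by exists (u, v); rewrite ?inE.
Qed.

Lemma rigidity_entry_pair (u v : G) i :
  u != v -> rigidity_entry p u i [set u; v] = direction (p u) (p v) i 0.
Proof.
move=> uv; rewrite /rigidity_entry; case: pickP => [w /eqP E|/(_ v)].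
  have : v \in [set u; w] by rewrite -E set22.
  by rewrite !inE eq_sym (negbTE uv) => /eqP->.
by rewrite eqxx.
Qed.

Lemma rigidity_entry_notin (u : G) i (E : {set G}) :
  u \notin E -> rigidity_entry p u i E = 0.
Proof.
move=> uE; rewrite /rigidity_entry; case: pickP => // w /eqP e.
by rewrite e set21 in uE.
Qed.

Lemma local_stiffness_mxE v i j :
  local_stiffness_mx p v i j
  = \sum_(u | adj v u) direction (p v) (p u) i 0 * direction (p v) (p u) j 0.
Proof.
rewrite mxE; under eq_bigr do rewrite !mxE.
rewrite -(big_enum_val (fun u => direction (p v) (p u) i 0
                                  * direction (p v) (p u) j 0)).
by apply: eq_bigl => u; rewrite inE.
Qed.

(** Rows u and v of the rigidity matrix overlap in the columns of the edges that
    contain both vertices: all edges at u when u = v, and otherwise at most the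
    edge uv, where the two direction vectors are opposite. *)
Lemma stiffness_mxE r c (u := (enum_val r).1) (v := (enum_val c).1)
    (i := (enum_val r).2) (j := (enum_val c).2) :
  stiffness_mx p r c =
  if u == v then local_stiffness_mx p u i j
  else - (direction (p u) (p v) i 0 * direction (p u) (p v) j 0) *+ adj u v.
Proof.
rewrite mxE; under eq_bigr do rewrite !mxE -/u -/v -/i -/j.
rewrite -(big_enum_val (fun E =>
  rigidity_entry p u i E * rigidity_entry p v j E)).
case: (eqVneq u v) => [<-|uv].
  rewrite local_stiffness_mxE (bigID (fun E : {set G} => u \in E)) /=.
  rewrite [X in _ + X]big1 ?addr0 => [|E /andP[_ uE]]; last first.
    by rewrite rigidity_entry_notin ?mul0r.
  rewrite (eq_bigl (mem [set [set u; w] | w in neighbors u])); last first.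
    move=> E /=; apply/andP/imsetP => [[/edgeP[a [b [ab ->]]]]|[w uw ->]].
      rewrite !inE => /orP[] /eqP e.
        by exists b; rewrite ?inE e.
      by exists a; rewrite ?inE e // 1?adj_sym // setUC.
    rewrite inE in uw.
    by split; rewrite ?set21 //; apply/edgeP; exists u, w.
  rewrite big_imset => [|a b _] /=; last first.
    rewrite inE => ub e.
    have : b \in [set u; a] by rewrite e set22.
    by rewrite !inE eq_sym (negbTE (adj_neq ub)) => /eqP.
  apply: eq_big => [w|w]; rewrite inE // => uw.
  by rewrite !rigidity_entry_pair ?(adj_neq uw).
have E0 (E : {set G}) : E \in edges G -> E != [set u; v] ->
    rigidity_entry p u i E * rigidity_entry p v j E = 0.
  move=> /edgeP[a [b [ab ->]]] ne.
  have [uE|uE] := boolP (u \in [set a; b]); last first.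
    by rewrite rigidity_entry_notin ?mul0r.
  have [vE|vE] := boolP (v \in [set a; b]); last first.
    by rewrite [X in _ * X]rigidity_entry_notin ?mulr0.
  case/negP: ne; rewrite eqEsubset !subUset !sub1set.
  move: uE vE uv; rewrite !inE => /orP[] /eqP-> /orP[] /eqP->;
    by rewrite ?eqxx ?orbT.
case: (boolP (adj u v)) => uv'.
  have uvE : [set u; v] \in edges G by apply/edgeP; exists u, v.
  rewrite (bigD1 _ uvE) /= big1 => [|E /andP[]]; last exact: E0.
  rewrite addr0 rigidity_entry_pair // setUC rigidity_entry_pair 1?eq_sym //.
  by rewrite [direction (p v) _]direction_opp mxE mulrN.
rewrite big1 // => E EG; apply: E0 => //; apply: contraNneq uv' => e.
move: EG; rewrite e => /edgeP[a [b [ab e']]].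
have : u \in [set a; b] by rewrite -e' set21.
have : v \in [set a; b] by rewrite -e' set22.
move: uv; rewrite !inE => /[swap] /orP[] /eqP-> /[swap] /orP[] /eqP->;
  by rewrite ?eqxx // adj_sym.
Qed.

End Entries.

(** * The stiffness matrix of a blow-up *)

Lemma scalemxE (R : pzRingType) m n a (A : 'M[R]_(m, n)) i j :
  (a *: A) i j = a * A i j.
Proof. by rewrite mxE. Qed.

Lemma local_stiffness_blowup (R : rcfType) d (G : sgraph) (p : G -> 'cV[R]_d)
    k (v : blowup G k) :
  local_stiffness_mx (blowup_map (k := k) p) v
  = k%:R *: local_stiffness_mx p v.1.
Proof.
apply/matrixP=> i j; rewrite [RHS]mxE !local_stiffness_mxE.
rewrite mulr_natl -sumrMnl.
under [RHS]eq_bigr do rewrite -[X in _ *+ X]card_ord -sumr_const.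
rewrite pair_big_dep /=; apply: eq_bigl => u.
by rewrite andbT.
Qed.

Definition local_diag (R : rcfType) d (G : sgraph) (p : G -> 'cV[R]_d)
  : 'M[R]_#|{: G * 'I_d}| :=
  \matrix_(r, c) (local_stiffness_mx p (enum_val r).1
     (enum_val r).2 (enum_val c).2 *+ ((enum_val r).1 == (enum_val c).1)).

Lemma local_diagE (R : rcfType) d (G : sgraph) (p : G -> 'cV[R]_d) r c :
  local_diag p r c = local_stiffness_mx p (enum_val r).1
    (enum_val r).2 (enum_val c).2 *+ ((enum_val r).1 == (enum_val c).1).
Proof. by rewrite mxE. Qed.

Lemma char_poly_local_diag (R : rcfType) d (G : sgraph) (p : G -> 'cV[R]_d) a :
  char_poly (a *: local_diag p)
  = \prod_v char_poly (a *: local_stiffness_mx p v).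
Proof.
rewrite (reindex (@enum_val G predT)) /=; last first.
  by exists enum_rank => x _; rewrite (enum_rankK, enum_valK).
rewrite -(char_poly_block_diag
  (fun i => a *: local_stiffness_mx p (enum_val i))).
apply: (char_poly_reindex (h := fun r : 'I__ =>
  mxtens_index (enum_rank (enum_val r).1, (enum_val r).2))).
- by rewrite card_prod card_ord.
- move=> r c /(can_inj (@mxtens_indexK _ _)) [/enum_rank_inj e1 e2].
  apply: enum_val_inj; move: e1 e2.
  by case: (enum_val r) (enum_val c) => [? ?] [? ?] /= -> ->.
- move=> r c; rewrite scalemxE local_diagE [RHS]mxE !mxtens_indexK /=.
  rewrite !enum_rankK scalemxE.
  by rewrite (inj_eq enum_rank_inj) mulrnAr.
Qed.

(** Reindexing ((u, a), i) as (a, (u, i)) turns the stiffness matrix of the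
    blow-up into J (x) (L - D) + 1 (x) kD: for distinct copies of one vertex the
    terms L and D cancel, and for equal copies the second summand restores the
    diagonal block k L^u. *)
Lemma char_poly_stiffness_blowup (R : rcfType) d (G : sgraph)
    (p : G -> 'cV[R]_d) m :
  char_poly (stiffness_mx (blowup_map (k := m.+1) p))
  = char_poly (m.+1%:R *: stiffness_mx p)
    * (\prod_v char_poly (m.+1%:R *: local_stiffness_mx p v)) ^+ m.
Proof.
pose D := local_diag p.
rewrite -char_poly_local_diag.
have -> : m.+1%:R *: stiffness_mx p
    = m.+1%:R *: (stiffness_mx p - D) + m.+1%:R *: D.
  by rewrite -scalerDr subrK.
rewrite -char_poly_ones_tens.
apply: (char_poly_reindex (h := fun r : 'I_#|{: blowup G m.+1 * 'I_d}| =>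
  let x := enum_val r in
  mxtens_index (x.1.2, enum_rank (x.1.1, x.2)))).
- by rewrite !card_prod !card_ord mulnCA mulnA.
- move=> r c /= /(can_inj (@mxtens_indexK _ _)) [e1 /enum_rank_inj [e2 e3]].
  apply: enum_val_inj; move: e1 e2 e3.
  by case: (enum_val r) (enum_val c) => [[? ?] ?] [[? ?] ?] /= -> -> ->.
move=> r c; rewrite stiffness_mxE local_stiffness_blowup [RHS]mxE !tensmxE.
rewrite [const_mx _ _ _]mxE [1%:M _ _]mxE !scalemxE.
rewrite [(_ - D) _ _]mxE [(- D) _ _]mxE !local_diagE.
rewrite stiffness_mxE !enum_rankK mul1r.
case: (enum_val r) (enum_val c) => [[u a] i] [[v b] j] /=.
rewrite xpair_eqE; case: (eqVneq u v) => [->|uv] /=.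
  rewrite mulr1n subrr add0r.
  case: eqP => _; rewrite ?mul1r // mul0r.
  by rewrite /blowup_adj adj_irrefl mulr0n.
by rewrite !mulr0n subr0 !mulr0 addr0.
Qed.

(** * The spectrum of a blow-up *)

Lemma count_mset_scale (R : rcfType) (a x : R) s :
  a != 0 -> count_mem x (mset_scale a s) = count_mem (a^-1 * x) s.
Proof.
move=> a0; rewrite count_map; apply: eq_count => y /=.
by rewrite -(inj_eq (mulfI (invr_neq0 a0))) mulKf.
Qed.

Lemma count_mset_repeat (R : rcfType) (x : R) m s :
  count_mem x (mset_repeat m s) = (m * count_mem x s)%N.
Proof.
by rewrite /mset_repeat count_flatten map_nseq sumnE big_nseq iter_addn_0 mulnC.
Qed.

Lemma spec_stiffness_blowup (R : rcfType) d (G : sgraph) (p : G -> 'cV[R]_d) k :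
  (0 < k)%N ->
  perm_eq (spec (stiffness_mx (blowup_map (k := k) p)))
    (mset_scale k%:R
       (flatten [seq mset_repeat k.-1 (spec (local_stiffness_mx p v))
                   | v <- enum G]
        ++ spec (stiffness_mx p))).
Proof.
case: k => // m _; set k := m.+1.
have k0 : k%:R != 0 :> R by rewrite pnatr_eq0.
have nz n (M : 'M[R]_n) : char_poly M != 0.
  by rewrite monic_neq0 ?char_poly_monic.
have nz_prod : \prod_v char_poly (k%:R *: local_stiffness_mx p v) != 0.
  by rewrite prodf_seq_neq0; apply/allP=> v _; rewrite nz.
apply/allP => x _ /=; apply/eqP.
rewrite count_spec char_poly_stiffness_blowup count_mset_scale //.
have kx : x = k%:R * (k%:R^-1 * x) by rewrite mulVKf.
rewrite mupM ?expf_neq0 // mup_exp // mup_prod //.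
rewrite count_cat count_spec {1}kx mup_char_poly_scale // addnC.
congr (_ + _)%N; rewrite count_flatten -map_comp sumnE big_map big_enum /=.
rewrite big_distrr; apply: eq_bigr => v _.
by rewrite count_mset_repeat count_spec [in LHS]kx mup_char_poly_scale.
Qed.

(** * Trivial infinitesimal motions *)

Lemma sum_indic (R : pzRingType) (I : finType) (F : I -> R) i :
  \sum_j F j *+ (j == i) = F i.
Proof.
by rewrite (bigD1 i) //= eqxx big1 ?addr0 // => j /negbTE->.
Qed.

Lemma card_le_pairs d :
  #|[set q : 'I_d * 'I_d | (q.1 <= q.2)%N]| = 'C(d.+1, 2).
Proof.
rewrite -sum1_card (eq_bigl (fun q : 'I_d * 'I_d => q.1 <= q.2)%N); last first.
  by move=> q; rewrite inE.
rewrite -(pair_big_dep xpredT (fun i j : 'I_d => i <= j)%N (fun _ _ => 1%N)) /=.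
rewrite (exchange_big_dep xpredT) //= -bin2_sum big_mkord big_ord_recl add0n.
apply: eq_bigr => j _.
rewrite -(big_mkord (fun i => i < j.+1)%N (fun=> 1%N)).
rewrite -(big_nat_widen _ _ _ predT _ (ltn_ord j)).
by rewrite sum_nat_const_nat muln1 subn0.
Qed.

(** For i <= j, these form a basis of the infinitesimal isometries of R^d: the
    diagonal pair (i, i) stands for the translation along the axis i, and the
    pair i < j for the rotation in the plane of the axes i and j. *)
Definition trivial_motion (R : rcfType) d (q : 'I_d * 'I_d) (x : 'cV[R]_d)
    (l : 'I_d) : R :=
  if q.1 == q.2 then (l == q.1)%:R
  else x q.1 0 *+ (l == q.2) - x q.2 0 *+ (l == q.1).

Lemma trivial_motion_isometry (R : rcfType) d q (x y : 'cV[R]_d) :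
  \sum_l (trivial_motion q x l - trivial_motion q y l) * (x - y) l 0 = 0.
Proof.
case: q => i j; rewrite /trivial_motion /=.
case: eqP => _; first by rewrite big1 // => l _; rewrite subrr mul0r.
rewrite (eq_bigr (fun l => ((x - y) i 0 * (x - y) l 0) *+ (l == j)
                          - ((x - y) j 0 * (x - y) l 0) *+ (l == i))).
  by rewrite sumrB !sum_indic mulrC subrr.
move=> l _; rewrite !mxE; case: (l == j); case: (l == i);
  rewrite ?mulr1n ?mulr0n; ring.
Qed.

Section Motions.
Variables (R : rcfType) (d : nat) (G : sgraph) (p : G -> 'cV[R]_d).

Let S := [set q : 'I_d * 'I_d | (q.1 <= q.2)%N].

Definition motion_mx : 'M[R]_(#|S|, #|{: G * 'I_d}|) :=
  \matrix_(s, r) trivial_motion (enum_val s) (p (enum_val r).1) (enum_val r).2.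

(** A trivial motion does not stretch any segment to first order, so it is
    orthogonal to every column of the rigidity matrix. *)
Lemma motion_mx_rigidity : motion_mx *m rigidity_mx p = 0.
Proof.
apply/matrixP=> s c; rewrite !mxE; under eq_bigr do rewrite !mxE.
set q := enum_val s; have := enum_valP c; move: (enum_val c) => E EG.
rewrite -(big_enum_val (fun z : G * 'I_d => trivial_motion q (p z.1) z.2
                                          * rigidity_entry p z.1 z.2 E)).
rewrite (eq_bigl xpredT) // -(pair_bigA _ (fun u l => trivial_motion q (p u) l
                                          * rigidity_entry p u l E)) /=.
have /edgeP[a [b [/adj_neq ab eE]]] := EG; subst E.
have ba : b != a by rewrite eq_sym.
rewrite (bigD1 a) //= (bigD1 b) //= [X in _ + (_ + X)]big1 => [|u /andP[ua ub]].
  rewrite addr0 -big_split /=.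
  have [t et] := directionE (p a) (p b).
  rewrite (eq_bigr (fun l => t * ((trivial_motion q (p a) l
       - trivial_motion q (p b) l) * (p a - p b) l 0))).
    by rewrite -mulr_sumr trivial_motion_isometry mulr0.
  move=> l _; rewrite rigidity_entry_pair // setUC rigidity_entry_pair //.
  rewrite [direction (p b) _]direction_opp et !mxE; ring.
rewrite big1 // => l _.
by rewrite rigidity_entry_notin ?mulr0 // !inE negb_or ua.
Qed.

(** A combination of the trivial motions is x |-> A x + t with A antisymmetric:
    this is its coordinate l, from which the coefficients can be read off. *)
Lemma sum_trivial_motion (C : 'I_d * 'I_d -> R) x l :
  \sum_(q in S) C q * trivial_motion q x l
  = C (l, l) + \sum_j (C (j, l) *+ (j < l)%N - C (l, j) *+ (l < j)%N) * x j 0.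
Proof.
rewrite (eq_bigl (fun q : 'I_d * 'I_d => (q.1 <= q.2)%N)); last first.
  by move=> q; rewrite inE.
pose f (i j : 'I_d) :=
  if (i <= j)%N then C (i, j) * trivial_motion (i, j) x l else 0.
rewrite big_mkcond /= (eq_bigr (fun q => f q.1 q.2)) => [|[] //].
rewrite -(pair_bigA _ f) /=.
have E (i j : 'I_d) : f i j
   = (C (i, j) *+ (l == i)) *+ (j == i)
   + (C (i, j) * x i 0 *+ (i < j)%N) *+ (j == l)
   - (C (i, j) * x j 0 *+ (i < j)%N) *+ (i == l).
  rewrite /f /trivial_motion /= [j == l]eq_sym [i == l]eq_sym [j == i]eq_sym.
  rewrite leq_eqVlt; case: (eqVneq i j) => [->|ij] /=.
    by rewrite !eqxx ltnn mulr1n !mulr0n !mul0rn addr0 subr0 mulr_natr.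
  rewrite (negbTE (ij : (i : nat) != j)) /= mulr0n add0r.
  by case: ltnP; rewrite ?mulr0n ?mul0rn ?subrr // mulr1n mulrBr !mulrnAr.
under eq_bigr => i _.
  under eq_bigr do rewrite E.
  rewrite sumrB big_split /= !sum_indic; over.
rewrite sumrB big_split /= -addrA; congr (_ + _).
  by under eq_bigr do rewrite eq_sym; rewrite (sum_indic (fun i => C (i, i))).
rewrite exchange_big /=; under [X in _ - X]eq_bigr do rewrite sum_indic.
rewrite -sumrB; apply: eq_bigr => j _.
by rewrite mulrBl !mulrnAl.
Qed.

(** If the combination A x + t vanishes at all the points p u, then each nonzero
    row of A defines an affine hyperplane containing them; so A = 0, and then
    t = 0 because there is at least one point. *)
Lemma motion_mx_free :
  (0 < d)%N -> ~ in_affine_hyperplane p -> row_free motion_mx.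
Proof.
move=> d0 hp; rewrite -kermx_eq0; apply/rowV0P => c /sub_kermxP cW.
(* The coefficient vector c, as a function of the pair instead of its rank. *)
pose C q : R := \sum_s c 0 s *+ (enum_val s == q).
have CE s : C (enum_val s) = c 0 s.
  rewrite /C; under eq_bigr do rewrite (inj_eq enum_val_inj).
  exact: sum_indic.
pose a l : 'cV[R]_d := \col_j (C (j, l) *+ (j < l)%N - C (l, j) *+ (l < j)%N).
have motion0 u l : \sum_j a l j 0 * p u j 0 = - C (l, l).
  apply/eqP; rewrite -subr_eq0 opprK addrC; apply/eqP.
  under eq_bigr do rewrite mxE.
  rewrite -sum_trivial_motion big_enum_val /=.
  have := congr1 (fun M : 'rV_#|{: G * 'I_d}| => M 0 (enum_rank (u, l))) cW.
  rewrite !mxE => {2}<-; apply: eq_bigr => s _.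
  by rewrite mxE enum_rankK CE.
have a0 l : a l = 0.
  case: (eqVneq (a l) 0) => // nz; case: hp.
  by exists (a l), (- C (l, l)).
have [u _|noG] := pickP (mem G); last first.
  case: hp; exists (const_mx 1), 0; split=> [|v]; last by have := noG v.
  apply/eqP => /matrixP/(_ (Ordinal d0) 0); rewrite !mxE; exact/eqP/oner_neq0.
apply/rowP=> s; rewrite -CE mxE.
have := enum_valP s; case: (enum_val s) => i j; rewrite inE /= leq_eqVlt.
case/orP=> [/eqP/val_inj->|ij].
  apply: oppr_inj; rewrite -(motion0 u) a0 oppr0 big1 // => l _.
  by rewrite mxE mul0r.
have := congr1 (fun M : 'cV_d => M i 0) (a0 j); rewrite !mxE ij.
by rewrite [(j < i)%N]ltnNge (ltnW ij) mulr1n mulr0n subr0.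
Qed.

Lemma count0_spec_stiffness : (0 < d)%N -> ~ in_affine_hyperplane p ->
  ('C(d.+1, 2) <= count_mem 0%R (spec (stiffness_mx p)))%N.
Proof.
move=> d0 hp; rewrite count_spec.
apply: leq_trans (mup0_char_poly_rank _).
have := mulmx0_rank_max motion_mx_rigidity.
have := motion_mx_free d0 hp; rewrite /row_free => /eqP->.
rewrite card_le_pairs => le_n; rewrite leq_subRL; last exact: rank_leq_row.
by apply: leq_trans le_n; rewrite addnC leq_add2l mxrankM_maxl.
Qed.

End Motions.

(** * The smallest eigenvalues *)

Section Lambda.
Variable R : rcfType.

Lemma head_sort_eq_mem (s t : seq R) :
  s =i t -> head 0 (sort <=%R s) = head 0 (sort <=%R t).
Proof.
move=> st.
have {}st x : (x \in sort <=%R s) = (x \in sort <=%R t) by rewrite !mem_sort.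
move: st (sort_le_sorted s) (sort_le_sorted t).
case: (sort _ s) => [|x s']; case: (sort _ t) => [|y t'] //= st.
- by have := st y; rewrite inE eqxx.
- by have := st x; rewrite inE eqxx.
move=> /(order_path_min le_trans)/allP sx /(order_path_min le_trans)/allP ty.
apply/le_anti/andP; split.
  by have := mem_head y t'; rewrite -st inE => /predU1P[->|/sx].
by have := mem_head x s'; rewrite st inE => /predU1P[->|/ty].
Qed.

Lemma nth_sort_zeros m (w : seq R) : {in w, forall x, 0 <= x} ->
  nth 0 (sort <=%R (nseq m 0 ++ w)) m = head 0 (sort <=%R w).
Proof.
move=> w0.
have -> : sort <=%R (nseq m 0 ++ w) = nseq m 0 ++ sort <=%R w.
  apply: le_sorted_eq; first exact: sort_le_sorted; last first.
    by rewrite perm_sort perm_cat2l perm_sym perm_sort.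
  elim: m => [|m IH] /=; first exact: sort_le_sorted.
  rewrite path_min_sorted //; apply/allP=> x; rewrite mem_cat mem_sort.
  by case/orP=> [/nseqP[->]|/w0].
by rewrite nth_cat size_nseq ltnn subnn nth0.
Qed.

Lemma nth_sort_scale (a : R) (s : seq R) i : 0 < a ->
  nth 0 (sort <=%R (mset_scale a s)) i = a * nth 0 (sort <=%R s) i.
Proof.
move=> a0; rewrite /mset_scale -(map_sort (leT' := <=%R)) => [|x y]; last first.
  by rewrite ler_pM2l.
(* Past the end both sides are the default value 0, which scaling fixes. *)
have [lt|ge] := ltnP i (size (sort <=%R s)); first by rewrite (nth_map 0).
by rewrite !nth_default ?size_map // mulr0.
Qed.

End Lambda.

Theorem corollary1p2 (R : realType) (d : nat) (hd : (1 <= d)%N)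
    (G : sgraph) (p : G -> 'cV[R]_d) (hp : ~ in_affine_hyperplane p)
    (k : nat) (hk : (2 <= k)%N) :
  perm_eq (spec (stiffness_mx (blowup_map (k := k) p)))
    (mset_scale k%:R
       (flatten [seq mset_repeat k.-1 (spec (local_stiffness_mx p v))
                   | v <- enum G]
        ++ spec (stiffness_mx p)))
  /\
  lambda ('C(d.+1, 2)).+1 (stiffness_mx (blowup_map (k := k) p))
  = k%:R / 2%:R
    * lambda ('C(d.+1, 2)).+1 (stiffness_mx (blowup_map (k := 2%N) p)).
Proof.
split; first by apply: spec_stiffness_blowup; apply: ltnW.
set m := 'C(d.+1, 2).
(* The eigenvalues of the stiffness matrix other than m of its zeros. *)
have [z Lz] : exists z, perm_eq (spec (stiffness_mx p)) (nseq m 0 ++ z).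
  pose s := spec (stiffness_mx p).
  exists (nseq (count_mem 0 s - m) 0 ++ filter (predC1 0) s).
  rewrite catA -nseqD subnKC ?count0_spec_stiffness //.
  rewrite -(perm_filterC (pred1 0)) -/s perm_sym perm_cat2r //.
  by have /all_pred1P-> := filter_all (pred1 0) s; rewrite size_filter.
pose w n := flatten [seq mset_repeat n.-1 (spec (local_stiffness_mx p v))
                       | v <- enum G] ++ z.
have w_mem n : (2 <= n)%N -> w n =i w 2%N.
  case: n => [|[|n]] // _ x; rewrite /w !mem_cat; congr (_ || _).
  apply/flatten_mapP/flatten_mapP => -[v vG]; rewrite /mset_repeat /= => xv;
    exists v => //=; move: xv.
    rewrite cats0 mem_cat => /orP[//|]; elim: n => //= l IH.
    by rewrite mem_cat => /orP[|/IH].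
  by rewrite cats0 mem_cat => ->.
have w_ge0 n : {in w n, forall x, 0 <= x}.
  move=> x; rewrite mem_cat => /orP[/flatten_mapP[v _]|xz].
    rewrite /mset_repeat; elim: n.-1 => //= l IH; rewrite mem_cat => /orP[|//].
    exact: spec_gram_ge0.
  have : x \in spec (stiffness_mx p) by rewrite (perm_mem Lz) mem_cat xz orbT.
  exact: spec_gram_ge0.
have lambdaE n : (2 <= n)%N ->
    lambda m.+1 (stiffness_mx (blowup_map (k := n) p))
    = n%:R * head 0 (sort <=%R (w 2%N)).
  move=> n2; rewrite /lambda /=.
  have /perm_sort_leP-> := spec_stiffness_blowup p (ltnW n2).
  rewrite nth_sort_scale ?ltr0n ?(ltnW n2) //; congr (_ * _).
  rewrite -(head_sort_eq_mem (w_mem _ n2)) -(nth_sort_zeros m) //.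
  congr nth; apply/perm_sort_leP.
  rewrite (perm_trans (perm_cat (perm_refl _) Lz)) // /w.
  by rewrite perm_catCA.
by rewrite !lambdaE // mulrA divfK // pnatr_eq0.
Qed.
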